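(* For integers $m\ge 1$ let $$T(m)=\sum_{r=2}^{m+1}\binom{2r}{r}\binom{m+1}{r}\frac{r-1}{2^{r}\binom{4m}{r}}.$$ Then $T$ is monotone increasing for $m\ge 2$, that is, $T(m)\le T(m+1)$ for every integer $m\ge 2$. *)

(* Defs.v *)
From mathcomp Require Import all_boot all_order all_algebra.

Set Implicit Arguments.
Unset Strict Implicit.
Unset Printing Implicit Defensive.

Import Order.TTheory GRing.Theory Num.Theory.
Local Open Scope ring_scope.

(* Only meant for [0 < m]: then [r <= m + 1 <= 4 * m], so no denominator
   vanishes.  Binomials are computed in [nat] and then cast to [rat]. *)
Definition T (m : nat) : rat :=
  \sum_(2 <= r < m.+2)
    'C(2 * r, r)%:R * 'C(m + 1, r)%:R
      * ((r%:R - 1) / (2 ^+ r * 'C(4 * m, r)%:R)).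

(* Main.v *)
Require Import Defs.
From mathcomp Require Import all_boot all_order all_algebra.
From mathcomp Require Import ring lra zify.

Import Order.TTheory GRing.Theory Num.Theory.
Local Open Scope ring_scope.

(** Write [T m] as a sum over [r] of positive weights times the ratios
    C(m+1, r) / C(4m, r) = \prod_(i < r) (m+1-i) / (4m-i). The factors with
    [2 <= i] are nondecreasing in [m], and so is the product for [r = 4];
    hence every term with [4 <= r] is nondecreasing. Only the terms [r = 2, 3]
    decrease, and the increase of the terms [r = 4, 5, 6] already makes up for
    it. *)

Definition bin_ratio (m r : nat) : rat := 'C(m.+1, r)%:R / 'C(4 * m, r)%:R.

Definition weight (r : nat) : rat := 'C(2 * r, r)%:R * (r%:R - 1) / 2 ^+ r.

Lemma weight_ge0 r : (0 < r)%N -> 0 <= weight r.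
Proof.
move=> r0; rewrite /weight mulr_ge0 ?invr_ge0 ?exprn_ge0 //.
by rewrite mulr_ge0 // subr_ge0 ler1n.
Qed.

Lemma bin_ratio_ge0 m r : 0 <= bin_ratio m r.
Proof. by rewrite /bin_ratio divr_ge0. Qed.

Lemma bin_ratio_small m r : (m.+1 < r)%N -> bin_ratio m r = 0.
Proof. by move=> h; rewrite /bin_ratio bin_small // mul0r. Qed.

(** The free bound [n] lets [T m] and [T (m + 1)] be compared over one range: the added terms vanish
    because ['C(m.+1, r)] does. *)
Lemma T_bin_ratio m n : (m.+2 <= n)%N ->
  T m = \sum_(2 <= r < n) weight r * bin_ratio m r.
Proof.
move=> le_mn; rewrite (big_cat_nat (n := m.+2)) //=.
rewrite [X in _ + X]big_nat_cond [X in _ + X]big1 ?addr0; last first.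
  by move=> r /andP[/andP[h _] _]; rewrite bin_ratio_small ?mulr0.
apply: eq_bigr => r _; rewrite /weight /bin_ratio addn1 invfM.
by ring.
Qed.

Lemma bin_natrS n r :
  'C(n, r.+1)%:R = 'C(n, r)%:R * (n%:R - r%:R) / r.+1%:R :> rat.
Proof.
apply: (canRL (mulfK _)); first by rewrite pnatr_eq0.
have [le_rn|lt_nr] := leqP r n; last by rewrite !bin_small ?mul0r // ltnW.
by rewrite -natrB // -!natrM mulnC mul_bin_left mulnC.
Qed.

Lemma bin_ratioS m r : (r < 4 * m)%N ->
  bin_ratio m r.+1 = bin_ratio m r * ((m%:R + 1 - r%:R) / (4 * m%:R - r%:R)).
Proof.
move=> lt_r; rewrite /bin_ratio !bin_natrS -natr1 natrM.
have h1 : (4 * m%:R - r%:R : rat) != 0.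
  by rewrite -natrM subr_eq0 eqr_nat; lia.
have h2 : ('C(4 * m, r)%:R : rat) != 0.
  by rewrite pnatr_eq0 -lt0n bin_gt0 ltnW.
have h3 : (r%:R + 1 : rat) != 0 by rewrite natr1 pnatr_eq0.
by rewrite -(natr1 r); field; rewrite h1 h2 h3.
Qed.

Local Ltac side_conditions :=
  repeat (apply/andP; split); apply: lt0r_neq0; lra.

(** The closed forms from here to [bin_ratio6] come from repeated use of [bin_ratioS]. They remain
    valid for small [m] with [m.+1 < r], where one of the factors [x - 2], [x - 3], [x - 4] is
    zero. *)
Lemma bin_ratio2 m (x : rat) : (2 <= m)%N -> x = m%:R ->
  bin_ratio m 2 = (x + 1) / (4 * (4 * x - 1)).
Proof.
move=> hm def_x; have x_ge2 : 2 <= x by rewrite def_x ler_nat.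
rewrite !bin_ratioS; try lia.
rewrite /bin_ratio !bin0 -def_x.
by field; side_conditions.
Qed.

Lemma bin_ratio3 m (x : rat) : (2 <= m)%N -> x = m%:R ->
  bin_ratio m 3 = (x + 1) * (x - 1) / (8 * (4 * x - 1) * (2 * x - 1)).
Proof.
move=> hm def_x; have x_ge2 : 2 <= x by rewrite def_x ler_nat.
rewrite bin_ratioS; last lia.
rewrite (bin_ratio2 _ _ hm def_x) -def_x.
by field; side_conditions.
Qed.

Lemma bin_ratio4 m (x : rat) : (2 <= m)%N -> x = m%:R ->
  bin_ratio m 4 = (x + 1) * (x - 1) * (x - 2)
  / (8 * (4 * x - 1) * (2 * x - 1) * (4 * x - 3)).
Proof.
move=> hm def_x; have x_ge2 : 2 <= x by rewrite def_x ler_nat.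
rewrite bin_ratioS; last lia.
rewrite (bin_ratio3 _ _ hm def_x) -def_x.
by field; side_conditions.
Qed.

Lemma bin_ratio5 m (x : rat) : (2 <= m)%N -> x = m%:R ->
  bin_ratio m 5 = (x + 1) * (x - 2) * (x - 3)
  / (32 * (4 * x - 1) * (2 * x - 1) * (4 * x - 3)).
Proof.
move=> hm def_x; have x_ge2 : 2 <= x by rewrite def_x ler_nat.
(* The new factor is [(x - 3) / (4 * (x - 1))]; it cancels [x - 1] and turns 8 into 32. *)
rewrite bin_ratioS; last lia.
rewrite (bin_ratio4 _ _ hm def_x) -def_x.
by field; side_conditions.
Qed.

Lemma bin_ratio6 m (x : rat) : (2 <= m)%N -> x = m%:R ->
  bin_ratio m 6 = (x + 1) * (x - 2) * (x - 3) * (x - 4)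
  / (32 * (4 * x - 1) * (2 * x - 1) * (4 * x - 3) * (4 * x - 5)).
Proof.
move=> hm def_x; have x_ge2 : 2 <= x by rewrite def_x ler_nat.
rewrite bin_ratioS; last lia.
rewrite (bin_ratio5 _ _ hm def_x) -def_x.
by field; side_conditions.
Qed.

(** The five summands are the terms [r = 2, ..., 6] over the common denominator [head_den]. Its
    constant 512 is 16 * 32, from [weight 6] and [bin_ratio6]. *)
Definition head_num (x : rat) : rat := (x + 1) *
  (192 * (2 * x - 1) * (4 * x - 3) * (4 * x - 5)
   + 320 * (x - 1) * (4 * x - 3) * (4 * x - 5)
   + 840 * (x - 1) * (x - 2) * (4 * x - 5)
   + 504 * (x - 2) * (x - 3) * (4 * x - 5)
   + 1155 * (x - 2) * (x - 3) * (x - 4)).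

Definition head_den (x : rat) : rat :=
  512 * ((4 * x - 1) * (2 * x - 1) * (4 * x - 3) * (4 * x - 5)).

Lemma head_den_gt0 (y : rat) : 2 <= y -> 0 < head_den y.
Proof.
move=> y2; rewrite /head_den mulr_gt0 //.
by do 3![apply: mulr_gt0; last lra]; lra.
Qed.

Lemma head_sumE m (x : rat) : (2 <= m)%N -> x = m%:R ->
  \sum_(2 <= r < 7) weight r * bin_ratio m r = head_num x / head_den x.
Proof.
move=> hm def_x; have x_ge2 : 2 <= x by rewrite def_x ler_nat.
rewrite unlock /= (bin_ratio2 _ _ hm def_x) (bin_ratio3 _ _ hm def_x).
rewrite (bin_ratio4 _ _ hm def_x) (bin_ratio5 _ _ hm def_x).
rewrite (bin_ratio6 _ _ hm def_x).
have -> : weight 2 = 3 / 2 by [].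
have -> : weight 3 = 5 by [].
have -> : weight 4 = 105 / 8
  by rewrite /weight (_ : 'C(2 * 4, 4) = 70)%N; [field | vm_compute].
have -> : weight 5 = 63 / 2
  by rewrite /weight (_ : 'C(2 * 5, 5) = 252)%N; [field | vm_compute].
have -> : weight 6 = 1155 / 16
  by rewrite /weight (_ : 'C(2 * 6, 6) = 924)%N; [field | vm_compute].
rewrite /head_num /head_den.
by field; side_conditions.
Qed.

(** The cut at 7 is the least possible: the sum up to [r = 5], or any shorter one, decreases for
    large [m]. *)
Lemma head_le (m : nat) : (2 <= m)%N ->
  \sum_(2 <= r < 7) weight r * bin_ratio m r
    <= \sum_(2 <= r < 7) weight r * bin_ratio m.+1 r.
Proof.
move=> hm; rewrite (head_sumE _ _ hm erefl).
rewrite (head_sumE _ _ (leqW hm) erefl) -(natr1 m).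
have : 2 <= m%:R :> rat by rewrite ler_nat.
move: (m%:R) => x hx.
rewrite ler_pdivrMr; last exact: head_den_gt0.
rewrite mulrAC ler_pdivlMr; last by apply: head_den_gt0; lra.
have [y y0 ->] : exists2 y, 0 <= y & x = y + 2 by exists (x - 2); lra.
(* In [y] the difference of both sides has a single negative coefficient, that
   of degree 1; the square absorbs it. *)
have h1 : 0 <= (8 * y - 1) ^+ 2 by exact: sqr_ge0.
have := (exprn_ge0 2%N y0, exprn_ge0 3%N y0, exprn_ge0 4%N y0,
         exprn_ge0 5%N y0, exprn_ge0 6%N y0).
rewrite /head_num /head_den => -[[[[h2 h3] h4] h5] h6].
lra.
Qed.

Lemma bin_ratio4_le m : (2 <= m)%N -> bin_ratio m 4 <= bin_ratio m.+1 4.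
Proof.
move=> hm; rewrite (bin_ratio4 _ _ hm erefl).
rewrite (bin_ratio4 _ _ (leqW hm) erefl) -(natr1 m).
have : 2 <= m%:R :> rat by rewrite ler_nat.
move: (m%:R) => x hx.
have den_gt0 (y : rat) : 2 <= y ->
    0 < 8 * (4 * y - 1) * (2 * y - 1) * (4 * y - 3).
  by move=> y2; do 3![apply: mulr_gt0; last lra].
rewrite ler_pdivrMr; last exact: den_gt0.
rewrite [leRHS]mulrAC ler_pdivlMr; last by apply: den_gt0; lra.
(* In [y] the difference of the cross-multiplied sides has only nonnegative coefficients, so it is
   enough to know that the powers of [y] are nonnegative. *)
have [y y0 ->] : exists2 y, 0 <= y & x = y + 2 by exists (x - 2); lra.
have := (exprn_ge0 2%N y0, exprn_ge0 3%N y0, exprn_ge0 4%N y0,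
         exprn_ge0 5%N y0).
move=> -[[[h2 h3] h4] h5].
lra.
Qed.

(** Induction on [r] from 4: each step multiplies by the factor [(m + 1 - r) / (4 * m - r)], which
    is nondecreasing in [m]. *)
Lemma bin_ratio_le m r : (2 <= m)%N -> (4 <= r)%N ->
  bin_ratio m r <= bin_ratio m.+1 r.
Proof.
move=> hm; elim: r => // r IHr; rewrite leq_eqVlt => /predU1P[<-|le_4r].
  exact: bin_ratio4_le.
(* Either the left side is zero, or [r <= m] and the new factor is nonnegative, as [ler_pM]
   requires. *)
have [lt_mr|le_rm] := ltnP m.+1 r.+1.
  by rewrite bin_ratio_small ?bin_ratio_ge0.
rewrite !bin_ratioS; try lia.
have r4 : 4 <= r%:R :> rat by rewrite ler_nat.
have rm : r%:R <= m%:R :> rat by rewrite ler_nat.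
apply: ler_pM; rewrite ?bin_ratio_ge0 ?IHr //.
  by apply: divr_ge0; lra.
rewrite -natr1 ler_pdivrMr; last by lra.
rewrite mulrAC ler_pdivlMr; last by lra.
rewrite -subr_ge0.
(* With [a = m + 1 - r] and [b = 4 * m - r], the difference is
   [(a + 1) * b - a * (b + 4) = b - 4 * a], in which [m] cancels. *)
set d := (X in 0 <= X); have -> : d = 3 * r%:R - 4 by rewrite /d; ring.
by lra.
Qed.

Theorem theorem5p1 (m : nat) (hm : (2 <= m)%N) : T m <= T (m + 1)%N.
Proof.
(* The bound [m + 7] covers the ranges of both sums and is at least 7, so both can be split
   there. *)
rewrite addn1 !(T_bin_ratio _ (m + 7)); try lia.
rewrite !(big_cat_nat (m := 2) (n := 7) (p := (m + 7)%N)) ?leq_addl //=.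
apply: lerD; first exact: head_le.
apply: ler_sum_nat => r /andP[le_7r _].
by apply: ler_wpM2l; [apply: weight_ge0 | apply: bin_ratio_le]; lia.
Qed.
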